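(* The logic $\mathcal{DQDSHC}^3$ corresponding to the variety $\mathbb{DQDSHC}^3$ generated by the twenty three-element $\mathbb{DQDSH}$-chains is defined, as an axiomatic extension of $\mathcal{DQDSH}$, by the following axioms: (i) $[(\phi\to\bot)\to\bot]\Leftrightarrow_H{\sim}(\phi\to\bot)$; (ii) $[\phi\wedge{\sim}({\sim}\phi\to\bot)]\to_H[\psi\vee(\psi\to\bot)]$.
   Context: Language: $\langle\vee,\wedge,\to,\sim,\bot,\top\rangle$ of arities $2,2,2,1,0,0$. $\alpha\to_H\beta$ abbreviates $\alpha\to(\alpha\wedge\beta)$ and $\alpha\Leftrightarrow_H\beta$ abbreviates $(\alpha\to_H\beta)\wedge(\beta\to_H\alpha)$. The logic $\mathcal{DHMSH}$ is the Hilbert-style logic with axiom schemes: (A1) $\alpha\to_H(\alpha\vee\beta)$; (A2) $\beta\to_H(\alpha\vee\beta)$; (A3) $(\alpha\to_H\gamma)\to_H[(\beta\to_H\gamma)\to_H((\alpha\vee\beta)\to_H\gamma)]$; (A4) $(\alpha\wedge\beta)\to_H\alpha$; (A5) $(\gamma\to_H\alpha)\to_H[(\gamma\to_H\beta)\to_H(\gamma\to_H(\alpha\wedge\beta))]$; (A6) $\top$; (A7) $\bot\to_H\alpha$; (A8) $((\alpha\wedge\beta)\to_H\gamma)\to_H(\alpha\to_H(\beta\to_H\gamma))$; (A9) $(\alpha\to_H(\beta\to_H\gamma))\to_H((\alpha\wedge\beta)\to_H\gamma)$; (A10) $(\alpha\to_H\beta)\to_H((\beta\to_H\alpha)\to_H((\alpha\to\gamma)\to_H(\beta\to\gamma)))$;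 (A11) $(\alpha\to_H\beta)\to_H((\beta\to_H\alpha)\to_H((\gamma\to\beta)\to_H(\gamma\to\alpha)))$; (A12) $\top\to_H{\sim}\bot$; (A13) ${\sim}\top\to_H\bot$; (A14) ${\sim}(\alpha\wedge\beta)\to_H({\sim}\alpha\vee{\sim}\beta)$; and rules (SMP): from $\phi$ and $\phi\to_H\gamma$ deduce $\gamma$; (SCP): from $\phi\to_H\gamma$ deduce ${\sim}\gamma\to_H{\sim}\phi$ (both applicable to any formulas derived from the premises). An axiomatic extension is obtained by adjoining new axiom schemes and keeping the same rules. The logic $\mathcal{DQDSH}$ is the axiomatic extension of $\mathcal{DHMSH}$ by ${\sim}{\sim}(\alpha\vee\beta)\to_H({\sim}{\sim}\alpha\vee{\sim}{\sim}\beta)$; $({\sim}{\sim}\alpha\vee{\sim}{\sim}\beta)\to_H{\sim}{\sim}(\alpha\vee\beta)$; ${\sim}{\sim}{\sim}\alpha\to_H{\sim}\alpha$; ${\sim}\alpha\to_H{\sim}{\sim}{\sim}\alpha$; ${\sim}{\sim}\alpha\to_H\alpha$. A semi-Heyting algebra is an algebra $\langle L,\vee,\wedge,\to,0,1\rangle$ such that $\langle L,\vee,\wedge,0,1\rangle$ is a lattice with $0$ and $1$, and $x\wedge(x\to y)\approx x\wedge y$, $x\wedge(y\to z)\approx x\wedge[(x\wedge y)\to(x\wedge z)]$, $x\to x\approx1$. $\mathbb{DHMSH}$ is the variety of algebras $\langle A,\vee,\wedge,\to,{}',0,1\rangle$ such that $\langle A,\vee,\wedge,\to,0,1\rangle$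 is a semi-Heyting algebra and $0'\approx1$, $1'\approx0$, $(x\wedge y)'\approx x'\vee y'$; $\mathbb{DQDSH}$ is its subvariety defined by $(x\vee y)''\approx x''\vee y''$, $x'''\approx x'$, $x''\le x$. Formulas are interpreted with $\sim,\bot,\top$ as ${}',0,1$. The logic corresponding to a subvariety $\mathbb V$ of $\mathbb{DHMSH}$ is the unique axiomatic extension $\mathcal E$ of $\mathcal{DHMSH}$ such that $\mathbb V=\{\mathbf A\in\mathbb{DHMSH}:\mathbf A\models\delta\approx1\text{ for every theorem }\delta\text{ of }\mathcal E\}$. Up to isomorphism there are ten semi-Heyting algebras $\mathbf L_1,\dots,\mathbf L_{10}$ on the chain $0<a<1$. In all of them $0\to0=a\to a=1\to1=1$, $a\to0=1\to0=0$, $1\to a=a$, and the triples $(0\to a,\ 0\to1,\ a\to1)$ are: $\mathbf L_1:(1,1,1)$; $\mathbf L_2:(a,1,1)$; $\mathbf L_3:(1,1,a)$; $\mathbf L_4:(a,1,a)$; $\mathbf L_5:(a,a,1)$; $\mathbf L_6:(1,a,1)$; $\mathbf L_7:(a,a,a)$; $\mathbf L_8:(1,a,a)$; $\mathbf L_9:(0,0,1)$; $\mathbf L_{10}:(0,0,a)$. $\mathbf L_i^{dm}$ (resp. $\mathbf L_i^{dp}$) is the expansion of $\mathbf L_i$ by ${}'$ with $0'=1$, $1'=0$, $a'=a$ (resp. $a'=1$). $\mathbb{DQDSHC}^3$ is the variety generated by $\mathbf C_{20}=\{\mathbf L_i^{dm},\mathbf L_i^{dp}:1\le i\le10\}$.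 *)

(* Defs.v *)
From mathcomp Require Import all_boot.

Set Implicit Arguments.
Unset Strict Implicit.
Unset Printing Implicit Defensive.

Declare Scope fm_scope.
Delimit Scope fm_scope with fm.

Inductive formula : Type :=
| Var of nat
| Or of formula & formula
| And of formula & formula
| Imp of formula & formula
| Neg of formula
| Bot
| Top.

Bind Scope fm_scope with formula.

Notation "α ∨ β" := (Or α β) (at level 85, right associativity) : fm_scope.
Notation "α ∧ β" := (And α β) (at level 80, right associativity) : fm_scope.
Notation "α ⇒ β" := (Imp α β) (at level 90, right associativity) : fm_scope.
Notation "∼ α" := (Neg α) (at level 75, right associativity) : fm_scope.
Notation "⊥" := Bot (at level 0) : fm_scope.
Notation "⊤" := Top (at level 0) : fm_scope.

Definition ImpH (α β : formula) : formula := (α ⇒ (α ∧ β))%fm.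
Notation "α ⇒H β" := (ImpH α β) (at level 90, right associativity) : fm_scope.

Definition IffH (α β : formula) : formula := ((α ⇒H β) ∧ (β ⇒H α))%fm.
Notation "α ⇔H β" := (IffH α β) (at level 95, no associativity) : fm_scope.

Fixpoint subst (s : nat -> formula) (φ : formula) : formula :=
  match φ with
  | Var n => s n
  | Or α β => Or (subst s α) (subst s β)
  | And α β => And (subst s α) (subst s β)
  | Imp α β => Imp (subst s α) (subst s β)
  | Neg α => Neg (subst s α)
  | Bot => Bot
  | Top => Top
  end.

Definition subst_closed (D : formula -> Prop) : Prop :=
  forall s φ, D φ -> D (subst s φ).

Definition adjoin (Ax D : formula -> Prop) : formula -> Prop :=
  fun φ => Ax φ \/ D φ.

(* Axiom schemes are given by the set of all their instances. *)

Inductive DHMSH_axiom : formula -> Prop :=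
| A1 α β : DHMSH_axiom (α ⇒H (α ∨ β))
| A2 α β : DHMSH_axiom (β ⇒H (α ∨ β))
| A3 α β γ :
    DHMSH_axiom ((α ⇒H γ) ⇒H ((β ⇒H γ) ⇒H ((α ∨ β) ⇒H γ)))
| A4 α β : DHMSH_axiom ((α ∧ β) ⇒H α)
| A5 α β γ :
    DHMSH_axiom ((γ ⇒H α) ⇒H ((γ ⇒H β) ⇒H (γ ⇒H (α ∧ β))))
| A6 : DHMSH_axiom ⊤
| A7 α : DHMSH_axiom (⊥ ⇒H α)
| A8 α β γ :
    DHMSH_axiom (((α ∧ β) ⇒H γ) ⇒H (α ⇒H (β ⇒H γ)))
| A9 α β γ :
    DHMSH_axiom ((α ⇒H (β ⇒H γ)) ⇒H ((α ∧ β) ⇒H γ))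
| A10 α β γ :
    DHMSH_axiom ((α ⇒H β) ⇒H ((β ⇒H α) ⇒H ((α ⇒ γ) ⇒H (β ⇒ γ))))
| A11 α β γ :
    DHMSH_axiom ((α ⇒H β) ⇒H ((β ⇒H α) ⇒H ((γ ⇒ β) ⇒H (γ ⇒ α))))
| A12 : DHMSH_axiom (⊤ ⇒H ∼ ⊥)
| A13 : DHMSH_axiom (∼ ⊤ ⇒H ⊥)
| A14 α β : DHMSH_axiom (∼ (α ∧ β) ⇒H (∼ α ∨ ∼ β)).

Inductive DQDSH_new_axiom : formula -> Prop :=
| DQD1 α β : DQDSH_new_axiom (∼ ∼ (α ∨ β) ⇒H (∼ ∼ α ∨ ∼ ∼ β))
| DQD2 α β : DQDSH_new_axiom ((∼ ∼ α ∨ ∼ ∼ β) ⇒H ∼ ∼ (α ∨ β))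
| DQD3 α : DQDSH_new_axiom (∼ ∼ ∼ α ⇒H ∼ α)
| DQD4 α : DQDSH_new_axiom (∼ α ⇒H ∼ ∼ ∼ α)
| DQD5 α : DQDSH_new_axiom (∼ ∼ α ⇒H α).

Definition DQDSH_axiom : formula -> Prop :=
  adjoin DHMSH_axiom DQDSH_new_axiom.

Inductive DQDSHC3_new_axiom : formula -> Prop :=
| DQDSHC3_i φ :
    DQDSHC3_new_axiom (((φ ⇒ ⊥) ⇒ ⊥) ⇔H ∼ (φ ⇒ ⊥))
| DQDSHC3_ii φ ψ :
    DQDSHC3_new_axiom ((φ ∧ ∼ (∼ φ ⇒ ⊥)) ⇒H (ψ ∨ (ψ ⇒ ⊥))).

Definition logic : Type := (formula -> Prop) -> formula -> Prop.

(* SCP is a global rule: it applies to consequences of the premises G, not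
   only to theorems. *)
Inductive derives (Ax G : formula -> Prop) : formula -> Prop :=
| d_axiom φ : Ax φ -> derives Ax G φ
| d_premise φ : G φ -> derives Ax G φ
| d_SMP φ γ : derives Ax G φ -> derives Ax G (φ ⇒H γ) -> derives Ax G γ
| d_SCP φ γ : derives Ax G (φ ⇒H γ) -> derives Ax G (∼ γ ⇒H ∼ φ).

Definition logic_theorem (L : logic) (φ : formula) : Prop :=
  L (fun _ => False) φ.

Definition same_logic (L L' : logic) : Prop :=
  forall G φ, L G φ <-> L' G φ.

Definition axiomatic_extension (Ax : formula -> Prop) (L : logic) : Prop :=
  exists D, subst_closed D /\ same_logic L (derives (adjoin Ax D)).

Record algebra : Type := Algebra {
  carrier :> Type;
  join : carrier -> carrier -> carrier;
  meet : carrier -> carrier -> carrier;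
  imp : carrier -> carrier -> carrier;
  neg : carrier -> carrier;
  bot : carrier;
  top : carrier
}.

Arguments bot {_}.
Arguments top {_}.

Record bounded_lattice (A : algebra) : Prop := {
  joinC : forall x y : A, join x y = join y x;
  meetC : forall x y : A, meet x y = meet y x;
  joinA : forall x y z : A, join x (join y z) = join (join x y) z;
  meetA : forall x y z : A, meet x (meet y z) = meet (meet x y) z;
  join_meet : forall x y : A, join x (meet x y) = x;
  meet_join : forall x y : A, meet x (join x y) = x;
  join0 : forall x : A, join x bot = x;
  meet1 : forall x : A, meet x top = x
}.

Record semi_Heyting (A : algebra) : Prop := {
  sh_lattice : bounded_lattice A;
  sh_meet_imp : forall x y : A, meet x (imp x y) = meet x y;
  sh_meet_impr : forall x y z : A,
    meet x (imp y z) = meet x (imp (meet x y) (meet x z));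
  sh_imp_refl : forall x : A, imp x x = top
}.

Record DHMSH (A : algebra) : Prop := {
  dhm_sh : semi_Heyting A;
  dhm_neg0 : neg bot = top :> A;
  dhm_neg1 : neg top = bot :> A;
  dhm_negI : forall x y : A, neg (meet x y) = join (neg x) (neg y)
}.

Definition le (A : algebra) (x y : A) : Prop := meet x y = x.

Record DQDSH (A : algebra) : Prop := {
  dqd_dhm : DHMSH A;
  dqd_negnegU : forall x y : A,
    neg (neg (join x y)) = join (neg (neg x)) (neg (neg y));
  dqd_neg3 : forall x : A, neg (neg (neg x)) = neg x;
  dqd_negneg_le : forall x : A, le (neg (neg x)) x
}.

Fixpoint eval (A : algebra) (v : nat -> A) (φ : formula) : A :=
  match φ with
  | Var n => v n
  | Or α β => join (eval v α) (eval v β)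
  | And α β => meet (eval v α) (eval v β)
  | Imp α β => imp (eval v α) (eval v β)
  | Neg α => neg (eval v α)
  | Bot => bot
  | Top => top
  end.

Definition valid (A : algebra) (φ : formula) : Prop :=
  forall v : nat -> A, eval v φ = top.

Record is_hom (A B : algebra) (f : A -> B) : Prop := {
  hom_join : forall x y, f (join x y) = join (f x) (f y);
  hom_meet : forall x y, f (meet x y) = meet (f x) (f y);
  hom_imp : forall x y, f (imp x y) = imp (f x) (f y);
  hom_neg : forall x, f (neg x) = neg (f x);
  hom_bot : f bot = bot;
  hom_top : f top = top
}.

Definition product (I : Type) (F : I -> algebra) : algebra := {|
  carrier := forall i, F i;
  join := fun x y i => join (x i) (y i);
  meet := fun x y i => meet (x i) (y i);
  imp := fun x y i => imp (x i) (y i);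
  neg := fun x i => neg (x i);
  bot := fun i => bot;
  top := fun i => top
|}.

(* Closure under H, S and P. Subalgebras are taken up to isomorphism, as
   injective homomorphisms into a member of the class. *)
Record is_variety (V : algebra -> Prop) : Prop := {
  variety_H : forall (A B : algebra) (f : A -> B),
    is_hom f -> (forall y, exists x, f x = y) -> V A -> V B;
  variety_S : forall (A B : algebra) (f : A -> B),
    is_hom f -> injective f -> V B -> V A;
  variety_P : forall (I : Type) (F : I -> algebra),
    (forall i, V (F i)) -> V (product F)
}.

Definition variety_generated (K : algebra -> Prop) (A : algebra) : Prop :=
  forall V, is_variety V -> (forall B, K B -> V B) -> V A.

Inductive chain3 : Type := c0 | ca | c1.

Definition chain3_join (x y : chain3) : chain3 :=
  match x, y with
  | c1, _ | _, c1 => c1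
  | ca, _ | _, ca => ca
  | c0, c0 => c0
  end.

Definition chain3_meet (x y : chain3) : chain3 :=
  match x, y with
  | c0, _ | _, c0 => c0
  | ca, _ | _, ca => ca
  | c1, c1 => c1
  end.

(* The triple (0 -> a, 0 -> 1, a -> 1) of L_i, with junk value for i outside
   1..10. *)
Definition L_triple (i : nat) : chain3 * chain3 * chain3 :=
  match i with
  | 1 => (c1, c1, c1)
  | 2 => (ca, c1, c1)
  | 3 => (c1, c1, ca)
  | 4 => (ca, c1, ca)
  | 5 => (ca, ca, c1)
  | 6 => (c1, ca, c1)
  | 7 => (ca, ca, ca)
  | 8 => (c1, ca, ca)
  | 9 => (c0, c0, c1)
  | 10 => (c0, c0, ca)
  | _ => (c0, c0, c0)
  end.

Definition L_imp (i : nat) (x y : chain3) : chain3 :=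
  let: (zero_a, zero_one, a_one) := L_triple i in
  match x, y with
  | c0, c0 => c1
  | c0, ca => zero_a
  | c0, c1 => zero_one
  | ca, c0 => c0
  | ca, ca => c1
  | ca, c1 => a_one
  | c1, _ => y
  end.

Definition L_expansion (i : nat) (nega : chain3) : algebra := {|
  carrier := chain3;
  join := chain3_join;
  meet := chain3_meet;
  imp := L_imp i;
  neg := fun x => match x with c0 => c1 | ca => nega | c1 => c0 end;
  bot := c0;
  top := c1
|}.

Definition L_dm (i : nat) : algebra := L_expansion i ca.
Definition L_dp (i : nat) : algebra := L_expansion i c1.

Inductive C20 : algebra -> Prop :=
| C20_dm i : 1 <= i <= 10 -> C20 (L_dm i)
| C20_dp i : 1 <= i <= 10 -> C20 (L_dp i).

Lemma C20_DQDSH_chain A :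
  C20 A -> DQDSH A /\ forall x y : A, le x y \/ le y x.
Proof.
have dqd i n : 1 <= i <= 10 -> n = ca \/ n = c1 -> DQDSH (L_expansion i n).
  move=> lei nE; move: i lei; case: nE => -> [|[|[|[|[|[|[|[|[|[|[|i]]]]]]]]]]] // _;
    by do !constructor; do ?case.
have tot i n (x y : L_expansion i n) : le x y \/ le y x.
  by case: x y => [] []; rewrite /le /=; auto.
case=> i lei; (split; last exact: tot).
- by apply: (dqd i ca lei); left.
- by apply: (dqd i c1 lei); right.
Qed.

Definition DQDSHC3 : algebra -> Prop := variety_generated C20.

Definition axiomatizes (L : logic) (V : algebra -> Prop) : Prop :=
  axiomatic_extension DHMSH_axiom L /\
  forall A : algebra,
    V A <-> DHMSH A /\ forall δ, logic_theorem L δ -> valid A δ.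

(* L is the unique axiomatic extension of DHMSH whose class of models is V. *)
Definition corresponding_logic (V : algebra -> Prop) (L : logic) : Prop :=
  axiomatizes L V /\ forall L', axiomatizes L' V -> same_logic L' L.

(* Main.v *)
From HB Require Import structures.
From mathcomp Require Import all_boot generic_quotient.
From mathcomp Require Import boolp classical_sets.
Require Import Defs.

Set Implicit Arguments.
Unset Strict Implicit.
Unset Printing Implicit Defensive.

(** The proof has two halves.

    Algebra. Let [A] be a model of the axioms and write [x*] for [x → 0], the
    pseudocomplement of [x]. The axioms say that [x'' ≤ x], [x** = x*'] and
    [x ∧ x'*' ≤ y ∨ y*]. Call [b] central when [b ∧ b' = 0]; then [b] and [b']
    are complements, and [b ∧ x = b ∧ y] defines a congruence. All the elements
    [x*] are central. For a maximal filter [U] of [A], let [x] and [y] be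
    equivalent when [b ∧ x = b ∧ y] for some central [b] in [U]. In the quotient
    every [x*] is [0] or [1]; hence an element [x] other than [0] and [1], which
    has [x* = 0] and [x'* = 0], lies below every nonzero [y] by the last
    identity, so that there is at most one such element. The quotient is thus a
    chain with at most three elements, and the semi-Heyting identities leave
    only the twenty given chains and their two-element subalgebras ([germ_hom]).
    Zorn's lemma provides enough maximal filters to separate the points of [A]
    ([germ_separation]), so [A] embeds in a product of members of [C20].
    Conversely the models form a variety, and it is a finite computation that
    the chains are models. Hence [DQDSHC3] is the class of models of the axioms
    ([generated_models]).

    Logic. For an axiomatic extension of [DHMSH] and a set [G] of premises,
    formulas modulo interderivability from [G] form an algebra in [DHMSH] that
    validates the theorems of the extension and in which the canonical valuation
    gives the value [1] exactly to the consequences of [G]. Therefore two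
    extensions with the same models coincide ([axiomatizes_le]), which gives the
    uniqueness. That [→H] is the residual of the conjunction has to be extracted
    from the axioms: reflexivity and transitivity of derivable [→H] rest on the
    replacement of equivalents in [→], that is, on [A10] and [A11]. *)

(** * Order theory of semi-Heyting algebras *)

Section SemiHeytingTheory.

Variables (A : algebra) (shA : semi_Heyting A).
Implicit Types x y z : A.

Let latA := sh_lattice shA.
Let jC := joinC latA.
Let mC := meetC latA.
Let jA := joinA latA.
Let mA := meetA latA.

Lemma meetxx x : meet x x = x.
Proof. by rewrite -{2}(join_meet latA x x) (meet_join latA). Qed.

Lemma joinxx x : join x x = x.
Proof. by rewrite -{2}(meet_join latA x x) (join_meet latA). Qed.

Lemma le_join x y : le x y <-> join x y = y.
Proof.
rewrite /le; split=> [<-|<-]; last exact: meet_join latA x y.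
by rewrite jC mC (join_meet latA).
Qed.

Lemma le_refl x : le x x. Proof. exact: meetxx. Qed.

Lemma le_trans x y z : le x y -> le y z -> le x z.
Proof. by rewrite /le => xy yz; rewrite -xy -mA yz. Qed.

Lemma le_anti x y : le x y -> le y x -> x = y.
Proof. by rewrite /le => xy yx; rewrite -[x]xy mC. Qed.

Lemma leIl x y : le (meet x y) x.
Proof. by rewrite /le mC mA meetxx. Qed.

Lemma leIr x y : le (meet x y) y.
Proof. by rewrite mC; exact: leIl. Qed.

Lemma lexI z x y : le z x -> le z y -> le z (meet x y).
Proof. by rewrite /le mA => -> ->. Qed.

Lemma leUl x y : le x (join x y).
Proof. exact: meet_join latA x y. Qed.

Lemma leUr x y : le y (join x y).
Proof. by rewrite jC; exact: leUl. Qed.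

Lemma leUx x y z : le x z -> le y z -> le (join x y) z.
Proof. by move=> /le_join xz /le_join yz; apply/le_join; rewrite -jA yz. Qed.

Lemma le0x x : le bot x.
Proof. by apply/le_join; rewrite jC (join0 latA). Qed.

Lemma lex1 x : le x top.
Proof. exact: meet1 latA x. Qed.

Lemma le1x x : le top x -> x = top.
Proof. by move=> /(le_anti (lex1 x)). Qed.

Lemma lex0 x : le x bot -> x = bot.
Proof. by move=> /le_anti-> //; exact: le0x. Qed.

Lemma meet1x x : meet top x = x.
Proof. by rewrite mC (meet1 latA). Qed.

Lemma meet0x x : meet bot x = bot.
Proof. exact: le0x. Qed.

Lemma leI2 x y z t : le x y -> le z t -> le (meet x z) (meet y t).
Proof.
by move=> xy zt; apply: lexI; [apply: le_trans xy; exact: leIl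
                              |apply: le_trans zt; exact: leIr].
Qed.

(** The term [x → x ∧ y] is the residual of the meet, although [→] itself
    need not be. *)
Lemma le_impH x y z : le z (imp x (meet x y)) <-> le (meet z x) y.
Proof.
split=> [zxy|zxy].
  apply: le_trans (leIr x y).
  have := sh_meet_imp shA x (meet x y); rewrite mA meetxx => <-.
  by rewrite mC; apply: leI2 zxy; exact: le_refl.
rewrite /le in zxy *.
by rewrite (sh_meet_impr shA) mA zxy (sh_imp_refl shA) (meet1 latA).
Qed.

Lemma impH_eq1 x y : imp x (meet x y) = top <-> le x y.
Proof.
split=> [xy|xy].
  by rewrite -(meet1x x); apply: (le_impH _ _ _).1; rewrite xy; exact: le_refl.
by apply/le1x/(le_impH _ _ _).2; rewrite meet1x.
Qed.

Lemma meet_joinr x y z : meet x (join y z) = join (meet x y) (meet x z).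
Proof.
apply: le_anti; last first.
  by apply: leUx; apply: leI2; (exact: le_refl || exact: leUl || exact: leUr).
rewrite mC; apply: (le_impH _ _ _).1; apply: leUx; apply: (le_impH _ _ _).2;
  by rewrite mC; (exact: leUl || exact: leUr).
Qed.

Lemma imp0_bot x : meet (imp x bot) x = bot.
Proof. by rewrite mC (sh_meet_imp shA) mC meet0x. Qed.

(** [x → 0] is the pseudocomplement of [x]. *)
Lemma le_imp0 x y : le y (imp x bot) <-> meet y x = bot.
Proof.
have bot_meet : meet x bot = bot by rewrite mC meet0x.
have := le_impH x bot y; rewrite bot_meet => ->.
by split=> [/lex0|->]; last exact: le_refl.
Qed.

End SemiHeytingTheory.

Lemma neg_anti (A : algebra) (dA : DHMSH A) (x y : A) :
  le x y -> le (neg y) (neg x).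
Proof.
rewrite /le => xy; rewrite -[x]xy (dhm_negI dA).
exact: leUr (dhm_sh dA) _ _.
Qed.

(** * Germs at a maximal filter *)

(** In a model, [b ∧ b' = 0] makes [b'] a complement of [b]; such elements
    are the ones along which a model decomposes as a product. *)
Definition central (A : algebra) (b : A) : Prop := meet b (neg b) = bot.

(** Maximality of the proper filter [U] is stated in the form in which it is
    used: every element outside [U] is disjoint from some member of [U]. *)
Record max_filter (A : algebra) (U : A -> Prop) : Prop := {
  max_filter1 : U top;
  max_filterI : forall x y, U x -> U y -> U (meet x y);
  max_filterS : forall x y, le x y -> U x -> U y;
  max_filter0 : ~ U bot;
  max_filterN : forall z, ~ U z -> exists2 u, U u & meet u z = bot
}.

(** [x] and [y] have the same germ at [U] when they agree along some central
    member of [U]. *)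
Definition germ_eq (A : algebra) (U : A -> Prop) (x y : A) : Prop :=
  exists b, [/\ U b, central b & meet b x = meet b y].

(** The germ of [x] at [U], read in the chain [0 < a < 1]: it is [0] when
    [x*] is in [U], it is [1] when [x'*] is in [U], and [a] otherwise. *)
Definition germ (A : algebra) (U : A -> Prop) (x : A) : chain3 :=
  if `[< U (imp x bot) >] then c0
  else if `[< U (imp (neg x) bot) >] then c1 else ca.

Section Germs.

Variables (A : algebra) (dA : DHMSH A).
Hypothesis negneg_le : forall x : A, le (neg (neg x)) x.
Hypothesis imp0_imp0 : forall x : A, imp (imp x bot) bot = neg (imp x bot).
Hypothesis middle_le : forall x y : A,
  le (meet x (neg (imp (neg x) bot))) (join y (imp y bot)).
Implicit Types x y z b c : A.

Let shA := dhm_sh dA.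
Let latA := sh_lattice shA.
Let jC := joinC latA.
Let mC := meetC latA.
Let jA := joinA latA.
Let mA := meetA latA.

Lemma central_imp0 x : central (imp x bot).
Proof. by rewrite /central -imp0_imp0 mC imp0_bot. Qed.

Lemma central_meet b c : central b -> central c -> central (meet b c).
Proof.
rewrite /central => b0 c0; rewrite (dhm_negI dA) (meet_joinr shA).
rewrite {1}[meet b c]mC -2!mA b0 c0 ![meet _ bot]mC !(meet0x shA).
exact: joinxx.
Qed.

Lemma central_bot : central (bot : A).
Proof. exact: meet0x. Qed.

Lemma central_negK b : central b -> join b (neg b) = top.
Proof.
move=> b0; apply: (le1x shA).
rewrite -(dhm_neg0 dA) -b0 (dhm_negI dA) jC.
by apply: (leUx shA); [apply: (le_trans shA) (negneg_le b) (leUl shA _ _)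
                      |exact: leUr].
Qed.

Lemma central_join b c : central b -> central c -> central (join b c).
Proof.
rewrite /central => b0 c0; apply: (lex0 shA); rewrite mC (meet_joinr shA).
apply: (leUx shA); [rewrite -b0 mC | rewrite -c0 mC];
  apply: (leI2 shA); by [exact: le_refl | apply: neg_anti => //;
    (exact: leUl || exact: leUr)].
Qed.

Lemma central_neg_meet b x :
  central b -> meet b (neg (meet b x)) = meet b (neg x).
Proof.
by move=> b0; rewrite (dhm_negI dA) (meet_joinr shA) b0 jC (join0 latA).
Qed.

(** A central element disjoint from [x'] lies below [x]. *)
Lemma central_le b x : central b -> meet b (neg x) = bot -> le b x.
Proof.
move=> b0 bx; apply: (le_trans shA) (negneg_le x).
rewrite -(meet1 latA b) -(dhm_neg0 dA) -bx central_neg_meet //.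
exact: leIr.
Qed.

(** The elements [b'], for [b] central with [b ∧ x = b ∧ y], generate a proper
    filter; no maximal filter above it can contain such a [b]. *)
Lemma germ_separation x y : x <> y -> exists2 U, max_filter U & ~ germ_eq U x y.
Proof.
move=> xy.
pose J z := exists b, [/\ central b, meet b x = meet b y & le (neg b) z].
have J1 : J top.
  exists bot; split; [exact: central_bot | by rewrite !(meet0x shA) |].
  exact: lex1.
have JI u v : J u -> J v -> J (meet u v).
  move=> [b [b0 bxy bu]] [c [c0 cxy cv]]; exists (join b c); split.
  - exact: central_join.
  - rewrite ![meet (join b c) _]mC !(meet_joinr shA).
    by rewrite ![meet _ b]mC ![meet _ c]mC bxy cxy.
  - apply: (lexI shA); [apply: (le_trans shA) bu|apply: (le_trans shA) cv];
      by apply: neg_anti => //; (exact: leUl || exact: leUr).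
have JS u v : le u v -> J u -> J v.
  move=> uv [b [b0 bxy bu]]; exists b; split=> //.
  exact: (le_trans shA) bu uv.
have J0 : ~ J bot.
  move=> [b [b0 bxy /(lex0 shA) nb]]; apply: xy.
  have b1 : b = top by rewrite -(central_negK b0) nb (join0 latA).
  by move: bxy; rewrite b1 !(meet1x shA).
(* The last clause makes the empty set admissible, as the union of the empty
   chain. *)
pose P (X : set A) := [/\ forall u v, X u -> X v -> X (meet u v),
  forall u v, le u v -> X u -> X v, ~ X bot & forall u z, X u -> J z -> X z].
have PJ : P J by split=> // u z.
have [F FP Ftot|U [[UI US U0 UJ] Umax]] := @Zorn_bigcup A P.
  split.
  - move=> u v [X FX Xu] [Y FY Yv].
    have [XY|YX] := Ftot _ _ FX FY.
      by exists Y => //; have [YI _ _ _] := FP _ FY; apply: YI => //; exact: XY.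
    by exists X => //; have [XI _ _ _] := FP _ FX; apply: XI => //; exact: YX.
  - move=> u v uv [X FX Xu]; exists X => //.
    by have [_ XS _ _] := FP _ FX; exact: XS uv Xu.
  - by move=> [X FX]; have [_ _ X0 _] := FP _ FX.
  - move=> u z [X FX Xu] Jz; exists X => //.
    by have [_ _ _ XJ] := FP _ FX; exact: XJ Xu Jz.
have [u Uu] : exists u, U u.
  apply: contrapT => Unil; apply: (Umax J) => //; split=> [u Uu|/(_ _ J1) U1].
    by case: Unil; exists u.
  by case: Unil; exists top.
have JU z : J z -> U z by exact: UJ Uu.
exists U.
  split=> //; first exact: JU.
  move=> z Uz; apply: contrapT => nz.
  apply: (Umax (fun w => exists2 v, U v & le (meet v z) w)).
    split=> [v Uv|/(_ z)]; first by exists v => //; exact: leIl.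
    by apply/not_implyP; split=> //; exists u => //; exact: leIr.
  split.
  - move=> v w [v' Uv' v'v] [w' Uw' w'w]; exists (meet v' w'); first exact: UI.
    apply: (lexI shA); [apply: (le_trans shA) v'v|apply: (le_trans shA) w'w];
      by apply: (leI2 shA); [exact: leIl || exact: leIr | exact: le_refl].
  - move=> v w vw [v' Uv' v'v]; exists v' => //.
    exact: (le_trans shA) v'v vw.
  - by move=> [v Uv /(lex0 shA) v0]; apply: nz; exists v.
  - move=> _ v _ /JU Uv; exists v => //; exact: leIl.
move=> [b [Ub b0 bxy]]; apply: U0; rewrite -b0; apply: UI => //.
by apply: JU; exists b; split=> //; exact: le_refl.
Qed.

Variable U : A -> Prop.
Hypothesis mU : max_filter U.

Lemma germ_eq_refl x : germ_eq U x x.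
Proof.
exists top; split=> //; first exact: max_filter1 mU.
by rewrite /central (meet1x shA) (dhm_neg1 dA).
Qed.

Lemma germ_eq_sym x y : germ_eq U x y -> germ_eq U y x.
Proof. by case=> b [Ub b0 bxy]; exists b. Qed.

(** Two equalities of germs hold along a common central element. *)
Lemma germ_eq_pair x y z t : germ_eq U x y -> germ_eq U z t ->
  exists b, [/\ U b, central b, meet b x = meet b y & meet b z = meet b t].
Proof.
move=> [b [Ub b0 bxy]] [c [Uc c0 czt]]; exists (meet b c); split.
- exact: max_filterI.
- exact: central_meet.
- by rewrite [meet b c]mC -!mA bxy.
- by rewrite -!mA czt.
Qed.

Lemma germ_eq_trans x y z : germ_eq U x y -> germ_eq U y z -> germ_eq U x z.
Proof.
move=> xy yz; have [b [Ub b0 bxy byz]] := germ_eq_pair xy yz.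
by exists b; split=> //; rewrite bxy.
Qed.

Lemma germ_eq_join x y z t :
  germ_eq U x y -> germ_eq U z t -> germ_eq U (join x z) (join y t).
Proof.
move=> xy zt; have [b [Ub b0 bxy bzt]] := germ_eq_pair xy zt.
by exists b; split=> //; rewrite !(meet_joinr shA) bxy bzt.
Qed.

Lemma germ_eq_meet x y z t :
  germ_eq U x y -> germ_eq U z t -> germ_eq U (meet x z) (meet y t).
Proof.
move=> xy zt; have [b [Ub b0 bxy bzt]] := germ_eq_pair xy zt.
exists b; split=> //.
by rewrite mA bxy -mA [meet y z]mC mA bzt -mA [meet t y]mC.
Qed.

Lemma germ_eq_imp x y z t :
  germ_eq U x y -> germ_eq U z t -> germ_eq U (imp x z) (imp y t).
Proof.
move=> xy zt; have [b [Ub b0 bxy bzt]] := germ_eq_pair xy zt.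
by exists b; split=> //; rewrite (sh_meet_impr shA) bxy bzt -(sh_meet_impr shA).
Qed.

Lemma germ_eq_neg x y : germ_eq U x y -> germ_eq U (neg x) (neg y).
Proof.
move=> [b [Ub b0 bxy]]; exists b; split=> //.
by rewrite -(central_neg_meet x b0) bxy central_neg_meet.
Qed.

Lemma germ_eq_mem x y : germ_eq U x y -> U x -> U y.
Proof.
move=> [b [Ub _ bxy]] Ux; apply: (max_filterS mU) (leIr shA b y) _.
by rewrite -bxy; exact: max_filterI.
Qed.

Lemma mem_imp0_imp0 x : ~ U (imp x bot) -> U (imp (imp x bot) bot).
Proof.
move=> /(max_filterN mU)[u Uu ux].
by apply: (max_filterS mU) Uu; apply/(le_imp0 shA).
Qed.

Lemma mem_imp0 x : U (imp x bot) <-> germ_eq U x bot.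
Proof.
split=> [Ux|]; last first.
  move/germ_eq_imp/(_ (germ_eq_refl bot))/germ_eq_sym/germ_eq_mem; apply.
  by rewrite (sh_imp_refl shA); exact: max_filter1.
exists (imp x bot); split=> //; first exact: central_imp0.
by rewrite (imp0_bot shA) mC (meet0x shA).
Qed.

Lemma mem_neg_imp0 x : U (imp (neg x) bot) <-> germ_eq U x top.
Proof.
split=> [Ux|xt]; last first.
  by apply/mem_imp0; rewrite -(dhm_neg1 dA); exact: germ_eq_neg.
exists (imp (neg x) bot); split=> //; first exact: central_imp0.
rewrite (meet1 latA); apply: central_le; first exact: central_imp0.
exact: imp0_bot.
Qed.

Lemma germ_eq0 x : germ U x = c0 <-> germ_eq U x bot.
Proof.
rewrite /germ; case: asboolP; first by move=> /mem_imp0.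
by move=> Ux; split=> [|/mem_imp0 //]; case: ifP.
Qed.

Lemma not_germ_eq01 : ~ germ_eq U bot top.
Proof.
case=> b [Ub _]; rewrite mC (meet0x shA) (meet1 latA) => b0.
by apply: (max_filter0 mU); rewrite b0.
Qed.

Lemma germ_eq1 x : germ U x = c1 <-> germ_eq U x top.
Proof.
rewrite /germ; case: asboolP => [/mem_imp0 x0|_].
  by split=> // /(germ_eq_trans (germ_eq_sym x0)) /not_germ_eq01.
by case: asboolP => [/mem_neg_imp0 //|nUx]; split=> // /mem_neg_imp0.
Qed.

(** Where [x'*'] and [y**] hold, [x] lies below [y], because of
    [x ∧ x'*' ≤ y ∨ y*]. Hence all germs other than [0] and [1] coincide. *)
Lemma germ_a_le b x y : le b (neg (imp (neg x) bot)) ->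
  le b (imp (imp y bot) bot) -> le (meet b x) y.
Proof.
move=> bx by_.
have : le (meet b x) (meet (imp (imp y bot) bot) (join y (imp y bot))).
  apply: (lexI shA); first exact: le_trans shA _ _ _ (leIl shA _ _) by_.
  apply: (le_trans shA) (middle_le x y); rewrite mC.
  by apply: (leI2 shA) bx; exact: le_refl.
move=> /(le_trans shA); apply; rewrite (meet_joinr shA) (imp0_bot shA).
by rewrite (join0 latA); exact: leIr.
Qed.

Lemma germP x y : germ U x = germ U y <-> germ_eq U x y.
Proof.
split=> [|xy]; last first.
  have mem_imp0_eq z t :
      germ_eq U z t -> `[< U (imp z bot) >] = `[< U (imp t bot) >].
    move=> zt; have zt0 := germ_eq_imp zt (germ_eq_refl bot).
    by apply: asbool_equiv_eq; split; apply: germ_eq_mem => //;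
      exact: germ_eq_sym.
  by rewrite /germ (mem_imp0_eq _ _ xy) (mem_imp0_eq _ _ (germ_eq_neg xy)).
case Ex: (germ U x) => Ey.
- apply: (@germ_eq_trans _ bot); first exact/germ_eq0.
  exact/germ_eq_sym/germ_eq0.
- have mem_a z : ca = germ U z ->
      U (imp (imp z bot) bot) /\ U (imp (imp (neg z) bot) bot).
    rewrite /germ; case: asboolP => // z0; case: asboolP => // z1 _.
    by split; exact: mem_imp0_imp0.
  have [Ux Ux'] := mem_a _ (esym Ex); have [Uy Uy'] := mem_a _ Ey.
  pose b := meet (meet (imp (imp x bot) bot) (imp (imp (neg x) bot) bot))
                 (meet (imp (imp y bot) bot) (imp (imp (neg y) bot) bot)).
  have bx0 : le b (imp (imp x bot) bot).
    exact: le_trans shA _ _ _ (leIl shA _ _) (leIl shA _ _).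
  have bx1 : le b (imp (imp (neg x) bot) bot).
    exact: le_trans shA _ _ _ (leIl shA _ _) (leIr shA _ _).
  have by0 : le b (imp (imp y bot) bot).
    exact: le_trans shA _ _ _ (leIr shA _ _) (leIl shA _ _).
  have by1 : le b (imp (imp (neg y) bot) bot).
    exact: le_trans shA _ _ _ (leIr shA _ _) (leIr shA _ _).
  rewrite !imp0_imp0 in bx1 by1.
  exists b; split.
  + by rewrite /b; apply: (max_filterI mU); apply: (max_filterI mU).
  + by rewrite /b; apply: central_meet; apply: central_meet;
      exact: central_imp0.
  + apply: (le_anti shA); apply: (lexI shA); try exact: leIl.
      exact: germ_a_le.
    exact: germ_a_le.
- apply: (@germ_eq_trans _ top); first exact/germ_eq1.
  exact/germ_eq_sym/germ_eq1.
Qed.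

Lemma germ0 : germ U bot = c0.
Proof. exact/germ_eq0/germ_eq_refl. Qed.

Lemma germ1 : germ U top = c1.
Proof. exact/germ_eq1/germ_eq_refl. Qed.

(** A section of the germ map on its range: the choice of [a] matters only
    when some element has germ [a]. *)
Let germ_repr (a : A) (c : chain3) : A :=
  match c with c0 => bot | ca => a | c1 => top end.

(** The germ map is a homomorphism to one of the twenty chains; the chain is
    read off from the germs of [0 → a], [0 → 1], [a → 1] and [a'] for an element
    [a] of germ [ca]. *)
Lemma germ_hom : exists i n, C20 (L_expansion i n) /\
  @is_hom A (L_expansion i n) (germ U).
Proof.
(* [a] is an element of germ [ca] if there is one, and irrelevant otherwise. *)
have [a aP] : exists a, forall x, germ U (germ_repr a (germ U x)) = germ U x.
  have [[a ga]|noa] := pselect (exists a, germ U a = ca).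
    by exists a => x; case: (germ U x) => /=; rewrite ?germ0 ?germ1.
  exists bot => x; case gx: (germ U x) => /=; rewrite ?germ0 ?germ1 //.
  by case: noa; exists x.
set s := germ_repr a in aP.
have g1 x : germ U (neg x) = germ U (neg (s (germ U x))).
  exact/germP/germ_eq_neg/germP/esym/aP.
have g2 (op : A -> A -> A) (opP : forall x y z t, germ_eq U x y ->
    germ_eq U z t -> germ_eq U (op x z) (op y t)) x y :
    germ U (op x y) = germ U (op (s (germ U x)) (s (germ U y))).
  by apply/germP/opP; apply/germP/esym/aP.
have gI x y : germ U (meet x y) = chain3_meet (germ U x) (germ U y).
  rewrite (g2 _ germ_eq_meet); have := aP x; have := aP y.
  case: (germ U x) (germ U y) => [] [] /=; rewrite ?(meet0x shA) ?(meet1x shA)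
    ?(meet1 latA) ?(meetxx shA) 1?[meet _ bot]mC ?(meet0x shA) //.
have gU x y : germ U (join x y) = chain3_join (germ U x) (germ U y).
  rewrite (g2 _ germ_eq_join); have := aP x; have := aP y.
  have jx1 z : join z top = top by apply/(le_join shA)/(lex1 shA).
  by case: (germ U x) (germ U y) => [] [] /=; rewrite ?(join0 latA)
    1?[join bot _]jC ?(join0 latA) ?(joinxx shA) ?jx1 1?[join top _]jC ?jx1.
have gimp x y := g2 _ germ_eq_imp x y.
have i00 : imp bot bot = top :> A := sh_imp_refl shA bot.
have i11 : imp top top = top :> A := sh_imp_refl shA top.
have i1x x : imp top x = x.
  by rewrite -[LHS](meet1x shA) (sh_meet_imp shA) (meet1x shA).
have n0 := dhm_neg0 dA; have n1 := dhm_neg1 dA.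
have [ga|ga] := pselect (germ U a = ca); last first.
  (* No germ is [a]: the range is the two-element subalgebra of [L_1] or
     [L_9], according to the value of [0 → 1]. *)
  have noa x : germ U x <> ca by move=> gx; have := aP x; rewrite gx; exact: ga.
  have [i [lei gi]] : exists i,
      1 <= i <= 10 /\ L_imp i c0 c1 = germ U (imp bot top).
    by case E: (germ U (imp bot top));
      [exists 9 | case: (noa _ E) | exists 1].
  exists i, ca; split; first exact: C20_dm.
  split=> //=; [|by move=> x; rewrite g1; have := noa x; case: (germ U x)
    => //= _; rewrite ?n0 ?n1 ?germ0 ?germ1|exact: germ0|exact: germ1].
  move=> x y; rewrite gimp; have := noa x; have := noa y.
  case: (germ U x) (germ U y) => [] [] //= _ _;
    rewrite ?i00 ?i11 ?i1x ?germ0 ?germ1 -?gi //;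
    by rewrite /L_imp; case: (L_triple i) => [[]].
have gMI x y : chain3_meet (germ U x) (germ U (imp x y)) =
               chain3_meet (germ U x) (germ U y).
  by rewrite -!gI (sh_meet_imp shA).
have ia0 : germ U (imp a bot) = c0.
  by have := gMI a bot; rewrite ga germ0; case: (germ U _).
have iaa : imp a a = top := sh_imp_refl shA a.
have ia1 : germ U (imp a top) <> c0.
  by have := gMI a top; rewrite ga germ1; case: (germ U _).
(* [0 → a] and [0 → 1] are both zero or both nonzero at [U]: with the two
   possible values of [a → 1] this leaves ten cases. *)
have i0a : chain3_meet ca (germ U (imp bot a)) =
           chain3_meet ca (germ U (imp bot top)).
  rewrite -ga -!gI (sh_meet_impr shA) [in RHS](sh_meet_impr shA).
  by rewrite (meetxx shA) (meet1 latA).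
have na : germ U (neg a) <> c0.
  move=> /germ_eq0/germ_eq_neg; rewrite n0 => /germ_eq1 gnn.
  by have := gI (neg (neg a)) a; rewrite negneg_le gnn ga.
have [i [lei gi0 gi01 gi1]] : exists i, [/\ 1 <= i <= 10,
    L_imp i c0 ca = germ U (imp bot a), L_imp i c0 c1 = germ U (imp bot top)
    & L_imp i ca c1 = germ U (imp a top)].
  move: i0a ia1.
  case: (germ U (imp bot a)) (germ U (imp bot top)) (germ U (imp a top))
    => [] [] [] //= _ _;
    by [exists 1|exists 2|exists 3|exists 4|exists 5
       |exists 6|exists 7|exists 8|exists 9|exists 10].
exists i, (germ U (neg a)); split.
  by case: (germ U (neg a)) na => // _; [exact: C20_dm|exact: C20_dp].
split=> //=; [| |exact: germ0|exact: germ1].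
  move=> x y; rewrite gimp.
  case: (germ U x) (germ U y) => [] [] //=;
    rewrite ?i00 ?i11 ?i1x ?iaa ?germ0 ?germ1 ?ga ?ia0 -?gi0 -?gi01 -?gi1 //;
    by rewrite /L_imp; case: (L_triple i) => [[]].
by move=> x; rewrite g1; case: (germ U x) => //=; rewrite ?n0 ?n1 ?germ0 ?germ1.
Qed.

End Germs.

(** * Equational classes and soundness *)

Lemma eval_hom (A B : algebra) (f : A -> B) : is_hom f ->
  forall v φ, eval (f \o v) φ = f (eval v φ).
Proof.
case=> fU fI fimp fN f0 f1 v.
by elim=> //= [α -> β ->|α -> β ->|α -> β ->|α ->]; rewrite ?fU ?fI ?fimp ?fN.
Qed.

Lemma eval_product (I : Type) (F : I -> algebra) (v : nat -> product F) φ :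
  eval v φ = fun i => eval (fun n => v n i) φ.
Proof. by elim: φ => //= [α -> β ->|α -> β ->|α -> β ->|α ->]. Qed.

(** The algebras satisfying a set [E] of equations. *)
Definition satisfies (E : formula -> formula -> Prop) (A : algebra) : Prop :=
  forall φ ψ, E φ ψ -> forall v : nat -> A, eval v φ = eval v ψ.

Lemma satisfies_variety E : is_variety (satisfies E).
Proof.
split.
- move=> A B f fhom fsurj AE φ ψ Eφψ v.
  have [g gK] : exists g : B -> A, forall y, f (g y) = y.
    by exists (fun y => projT1 (cid (fsurj y))) => y; case: cid.
  have -> : v = f \o (g \o v) by apply: funext => n; rewrite /= gK.
  by rewrite !(eval_hom fhom) (AE _ _ Eφψ).
- move=> A B f fhom finj BE φ ψ Eφψ v.
  by apply: finj; rewrite -!(eval_hom fhom); exact: BE.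
- move=> I F FE φ ψ Eφψ v; rewrite !eval_product.
  apply: functional_extensionality_dep => i.
  exact: FE.
Qed.

(** The identities of [DHMSH], as pairs of formulas. *)
Inductive DHMSH_eqn : formula -> formula -> Prop :=
| EjoinC x y : DHMSH_eqn (x ∨ y) (y ∨ x)
| EmeetC x y : DHMSH_eqn (x ∧ y) (y ∧ x)
| EjoinA x y z : DHMSH_eqn (x ∨ (y ∨ z)) ((x ∨ y) ∨ z)
| EmeetA x y z : DHMSH_eqn (x ∧ (y ∧ z)) ((x ∧ y) ∧ z)
| Ejoin_meet x y : DHMSH_eqn (x ∨ (x ∧ y)) x
| Emeet_join x y : DHMSH_eqn (x ∧ (x ∨ y)) x
| Ejoin0 x : DHMSH_eqn (x ∨ ⊥) x
| Emeet1 x : DHMSH_eqn (x ∧ ⊤) x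
| Emeet_imp x y : DHMSH_eqn (x ∧ (x ⇒ y)) (x ∧ y)
| Emeet_impr x y z : DHMSH_eqn (x ∧ (y ⇒ z)) (x ∧ ((x ∧ y) ⇒ (x ∧ z)))
| Eimp_refl x : DHMSH_eqn (x ⇒ x) ⊤
| Eneg0 : DHMSH_eqn (∼ ⊥) ⊤
| Eneg1 : DHMSH_eqn (∼ ⊤) ⊥
| EnegI x y : DHMSH_eqn (∼ (x ∧ y)) (∼ x ∨ ∼ y).

Lemma DHMSH_satisfies A : DHMSH A <-> satisfies DHMSH_eqn A.
Proof.
split=> [[[[]]]|AE].
  by move=> *; move=> φ ψ [] * /=; auto.
pose v (x y z : A) n := nth z [:: x; y] n.
have AE3 φ ψ (Eφψ : DHMSH_eqn φ ψ) x y z := AE _ _ Eφψ (v x y z).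
do !split=> *.
- exact: AE3 (EjoinC (Var 0) (Var 1)) _ _ top.
- exact: AE3 (EmeetC (Var 0) (Var 1)) _ _ top.
- exact: AE3 (EjoinA (Var 0) (Var 1) (Var 2)) _ _ _.
- exact: AE3 (EmeetA (Var 0) (Var 1) (Var 2)) _ _ _.
- exact: AE3 (Ejoin_meet (Var 0) (Var 1)) _ _ top.
- exact: AE3 (Emeet_join (Var 0) (Var 1)) _ _ top.
- exact: AE3 (Ejoin0 (Var 0)) _ top top.
- exact: AE3 (Emeet1 (Var 0)) _ top top.
- exact: AE3 (Emeet_imp (Var 0) (Var 1)) _ _ top.
- exact: AE3 (Emeet_impr (Var 0) (Var 1) (Var 2)) _ _ _.
- exact: AE3 (Eimp_refl (Var 0)) _ top top.
- exact: AE3 Eneg0 top top top.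
- exact: AE3 Eneg1 top top top.
- exact: AE3 (EnegI (Var 0) (Var 1)) _ _ top.
Qed.

(** The algebras of [DHMSH] in which all of [Ax] takes the value [1]. *)
Definition models (Ax : formula -> Prop) (A : algebra) : Prop :=
  DHMSH A /\ forall δ, Ax δ -> valid A δ.

Lemma models_variety Ax : is_variety (models Ax).
Proof.
suff -> : models Ax = satisfies (fun φ ψ => DHMSH_eqn φ ψ \/ Ax φ /\ ψ = Top).
  exact: satisfies_variety.
apply: funext => A; apply/propext; split.
  by move=> [/DHMSH_satisfies AE AAx] φ ψ [/AE //|[/AAx Aφ ->] v]; exact: Aφ.
move=> AE; split; last by move=> δ Axδ v; apply: (AE δ Top); right.
by apply/DHMSH_satisfies => φ ψ Eφψ; apply: AE; left.
Qed.

Lemma eval_ImpH (A : algebra) (v : nat -> A) φ ψ : semi_Heyting A ->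
  eval v (φ ⇒H ψ) = top <-> le (eval v φ) (eval v ψ).
Proof. by move=> shA; exact: impH_eq1. Qed.

Lemma soundness (A : algebra) (v : nat -> A) (Ax G : formula -> Prop) :
  DHMSH A -> (forall δ, Ax δ -> eval v δ = top) ->
  (forall γ, G γ -> eval v γ = top) ->
  forall φ, derives Ax G φ -> eval v φ = top.
Proof.
move=> dA vAx vG φ; have shA := dhm_sh dA.
elim=> {φ} [φ /vAx //|φ /vG //|φ γ _ vφ _|φ γ _] /(eval_ImpH _ _ _ shA) vφγ.
  by move: vφγ; rewrite vφ => /(le1x shA).
exact/(eval_ImpH _ _ _ shA)/neg_anti.
Qed.

Lemma models_theorem Ax A : models Ax A <->
  models (logic_theorem (derives Ax)) A.
Proof.
split=> -[dA AAx]; split=> // δ Aδ; last by apply: AAx; exact: d_axiom.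
by move=> v; apply: soundness Aδ => // γ /AAx; exact.
Qed.

(** The axioms of [DQDSH] together with the two additional schemes. *)
Definition DQDSHC3_axiom : formula -> Prop :=
  adjoin DQDSH_axiom DQDSHC3_new_axiom.

(** Each axiom is evaluated in the twenty algebras at all values of its
    subformulas. *)
Lemma C20_models A : C20 A -> models DQDSHC3_axiom A.
Proof.
move=> C20A; split; first by case: (C20_DQDSH_chain C20A) => -[].
have [i [n [-> [lei nE]]]] : exists i n,
    A = L_expansion i n /\ 1 <= i <= 10 /\ (n = ca \/ n = c1).
  by case: C20A => i lei; exists i; [exists ca | exists c1]; auto.
move=> δ Dδ.
case: nE => ->; move: i lei => [|[|[|[|[|[|[|[|[|[|[|i]]]]]]]]]]] // _ v;
  case: Dδ => [[]|] [] * /=;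
  do ?[move: (eval v _); case]; by [].
Qed.

(** * Derivability and the Lindenbaum algebra *)

(* The classical equality and choice on formulas make the quotient by
   interderivability available. *)
HB.instance Definition _ := gen_eqMixin formula.
HB.instance Definition _ := gen_choiceMixin formula.

Open Scope quotient_scope.

Section Lindenbaum.

Variables Ax G : formula -> Prop.
Hypothesis DHMSH_Ax : forall δ, DHMSH_axiom δ -> Ax δ.
Implicit Types α β γ δ : formula.

Let ax δ (Dδ : DHMSH_axiom δ) : derives Ax G δ := d_axiom G (DHMSH_Ax Dδ).

(** Provable implication from the premises [G]. *)
Definition entails α β : Prop := derives Ax G (α ⇒H β).

(** Interderivability, which will be the kernel of the Lindenbaum algebra. *)
Definition equiv α β : Prop := entails α β /\ entails β α.

Lemma equiv_sym α β : equiv α β -> equiv β α.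
Proof. by case. Qed.

Lemma entails_top φ : derives Ax G φ -> forall α, entails α φ.
Proof.
move=> dφ α; apply: d_SMP dφ _.
exact: d_SMP (ax (A4 φ α)) (ax (A8 _ _ _)).
Qed.

Lemma curry α β γ : entails (α ∧ β) γ -> entails α (β ⇒H γ).
Proof. by move=> h; exact: d_SMP h (ax (A8 _ _ _)). Qed.

Lemma uncurry α β γ : entails α (β ⇒H γ) -> entails (α ∧ β) γ.
Proof. by move=> h; exact: d_SMP h (ax (A9 _ _ _)). Qed.

Lemma entails_andl α β : entails (α ∧ β) α.
Proof. exact: ax (A4 _ _). Qed.

Lemma entails_and α β γ : entails γ α -> entails γ β -> entails γ (α ∧ β).
Proof.
by move=> γα γβ; exact: d_SMP γβ (d_SMP γα (ax (A5 _ _ _))).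
Qed.

(** Weakening on the left, immediate from the axioms; the mirror image
    [entails_andwr] is not. *)
Lemma entails_andwl γ α β : entails α β -> entails (γ ∧ α) β.
Proof. by move=> αβ; exact/uncurry/entails_top. Qed.

Lemma equiv_impl α β γ : equiv α β -> derives Ax G (α ⇒ γ) ->
  derives Ax G (β ⇒ γ).
Proof.
move=> [αβ βα] h; apply: d_SMP h _.
exact: d_SMP βα (d_SMP αβ (ax (A10 _ _ _))).
Qed.

Lemma equiv_impr α β γ : equiv α β -> derives Ax G (γ ⇒ α) ->
  derives Ax G (γ ⇒ β).
Proof.
move=> [αβ βα] h; apply: d_SMP h _.
exact: d_SMP αβ (d_SMP βα (ax (A11 _ _ _))).
Qed.

(** [α →H α] is [α → α ∧ α]; it comes from [α →H ⊤], that is [α → α ∧ ⊤], by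
    replacing [α ∧ ⊤] with the equivalent [α ∧ α]. *)
Lemma entails_refl α : entails α α.
Proof.
have top_p := ax A6.
apply: equiv_impr (entails_top top_p α); split.
- by apply: entails_and; exact: entails_andl.
- by apply: entails_and; [exact: entails_andl | exact: entails_top].
Qed.

Lemma equiv_refl α : equiv α α.
Proof. by split; exact: entails_refl. Qed.

Lemma entails_andr α β : entails (α ∧ β) β.
Proof. exact/entails_andwl/entails_refl. Qed.

Lemma equiv_andC α β : equiv (α ∧ β) (β ∧ α).
Proof.
by split; apply: entails_and; by [exact: entails_andr|exact: entails_andl].
Qed.

(** [α →H γ] is [α → α ∧ γ], where [α ∧ γ] is equivalent to [β]; and [α → β]
    comes from [β → β]. *)
Lemma equiv_entails_trans α β γ : equiv α β -> equiv β γ -> entails α γ.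
Proof.
move=> αβ βγ; have [_ βα] := αβ; have [βγ' γβ] := βγ.
apply: (@equiv_impr β).
  by split; [exact: entails_and | exact: entails_andwl].
apply: equiv_impl (equiv_sym αβ) _; apply: equiv_impr (entails_refl β).
by split; [exact: entails_andl | apply: entails_and; exact: entails_refl].
Qed.

Lemma equiv_trans α β γ : equiv α β -> equiv β γ -> equiv α γ.
Proof.
move=> αβ βγ; split; first exact: equiv_entails_trans αβ βγ.
by apply: equiv_entails_trans (equiv_sym βγ) (equiv_sym αβ).
Qed.

Lemma entails_equiv_and α β : entails α β -> equiv α (α ∧ β).
Proof.
move=> αβ; split; last exact: entails_andl.
exact: entails_and (entails_refl α) αβ.
Qed.

Lemma equiv_and_entails α β : entails α (α ∧ β) -> entails α β.
Proof.
move=> h; apply: equiv_impr h.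
split; first exact: entails_andr.
by apply: entails_and; [exact: entails_andl|exact: entails_refl].
Qed.

(** The equivalences [α ∧ γ ~ γ ∧ α ~ (γ ∧ α) ∧ β ~ (α ∧ γ) ∧ β] give
    [α ∧ γ →H (α ∧ γ) ∧ β]. *)
Lemma entails_andwr γ α β : entails α β -> entails (α ∧ γ) β.
Proof.
move=> αβ; apply: equiv_and_entails.
have [F Q] := (equiv_andC α γ).
have wl : equiv (β ∧ (γ ∧ α)) (β ∧ (α ∧ γ)).
  by split; apply: entails_and; by [exact: entails_andl | exact: entails_andwl].
apply: (equiv_entails_trans (equiv_andC α γ)).
apply: equiv_trans (entails_equiv_and (entails_andwl γ αβ)) _.
apply: equiv_trans (equiv_andC _ _) _.
exact: equiv_trans wl (equiv_andC _ _).
Qed.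

(** [α ~ α ∧ β ~ (α ∧ β) ∧ γ ~ α ∧ γ]. *)
Lemma entails_trans α β γ : entails α β -> entails β γ -> entails α γ.
Proof.
move=> αβ βγ; apply: equiv_and_entails.
apply: equiv_entails_trans (entails_equiv_and αβ) _.
apply: equiv_trans (entails_equiv_and (entails_andwl α βγ)) _; split.
- by apply: entails_and; [apply/entails_andwr/entails_andl|exact: entails_andr].
- apply: entails_and; last exact: entails_andr.
  by apply: entails_and; [exact: entails_andl | exact: entails_andwr].
Qed.

Lemma entails_orl α β : entails α (α ∨ β).
Proof. exact: ax (A1 _ _). Qed.

Lemma entails_orr α β : entails β (α ∨ β).
Proof. exact: ax (A2 _ _). Qed.

Lemma entails_or α β γ : entails α γ -> entails β γ -> entails (α ∨ β) γ.
Proof. by move=> αγ βγ; exact: d_SMP βγ (d_SMP αγ (ax (A3 _ _ _))). Qed.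

(** Projections from, and pairings of, a conjunction of hypotheses. *)
Ltac entails_proj :=
  first [ by exact: entails_refl
        | by exact: entails_top (ax A6) _
        | by apply: entails_and; entails_proj
        | by apply: entails_andwr; entails_proj
        | by apply: entails_andwl; entails_proj ].

(** [A10] and [A11] under a hypothesis [δ]. *)
Lemma entails_imp δ α α' β β' : entails (δ ∧ α) α' -> entails (δ ∧ α') α ->
  entails (δ ∧ β) β' -> entails (δ ∧ β') β ->
  entails (δ ∧ (α ⇒ β)) (α' ⇒ β').
Proof.
move=> /curry a1 /curry a2 /curry b1 /curry b2.
have eA : entails (δ ∧ (α ⇒ β)) (α' ⇒ β).
  apply/uncurry; apply: entails_trans (entails_and (entails_refl δ) a2) _.
  apply/uncurry; apply: entails_trans a1 _; exact: ax (A10 _ _ _).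
have eB : entails (δ ∧ (α' ⇒ β)) (α' ⇒ β').
  apply/uncurry; apply: entails_trans (entails_and (entails_refl δ) b1) _.
  apply/uncurry; apply: entails_trans b2 _; exact: ax (A11 _ _ _).
by apply: entails_trans eB; apply: entails_and => //; exact: entails_andl.
Qed.

Lemma imp_refl α : derives Ax G (α ⇒ α).
Proof. by apply: equiv_impr (entails_refl α); split; entails_proj. Qed.

(** [⊤ →H β] is [⊤ → ⊤ ∧ β], and [⊤ ∧ β] is equivalent to [β]. *)
Lemma entails_top_imp β : entails (⊤ ⇒ β) β.
Proof.
have h : entails (⊤ ∧ (⊤ ⇒ β)) (⊤ ⇒H β) by apply: entails_imp; entails_proj.
have /uncurry h' : entails (⊤ ⇒ β) (⊤ ⇒H β).
  by apply: entails_trans h; entails_proj.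
by apply: entails_trans h'; entails_proj.
Qed.

(** From left to right, [α] makes [α] and [⊤] equivalent, so [α ⇒ β] becomes
    [⊤ ⇒ β]; from right to left, [α ∧ β] makes [α] and [β] equivalent, so
    [α ⇒ α] becomes [α ⇒ β]. *)
Lemma equiv_and_imp α β : equiv (α ∧ (α ⇒ β)) (α ∧ β).
Proof.
split; apply: entails_and; try exact: entails_andl.
  apply: entails_trans (entails_top_imp β).
  by apply: entails_imp; entails_proj.
apply: (@entails_trans _ ((α ∧ β) ∧ (α ⇒ α))).
  apply: entails_and; first exact: entails_refl.
  exact: entails_top (imp_refl α) _.
by apply: entails_imp; entails_proj.
Qed.

Lemma equiv_and_impr α β γ : equiv (α ∧ (β ⇒ γ)) (α ∧ ((α ∧ β) ⇒ (α ∧ γ))).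
Proof.
by split; apply: entails_and; try exact: entails_andl;
   apply: entails_imp; entails_proj.
Qed.

Lemma entails_neg α β : entails α β -> entails (∼ β) (∼ α).
Proof. exact: d_SCP. Qed.

Lemma DHMSH_eqn_equiv α β : DHMSH_eqn α β -> equiv α β.
Proof.
have orC x y : entails (x ∨ y) (y ∨ x).
  by apply: entails_or; [exact: entails_orr|exact: entails_orl].
have orl x y z : entails x y -> entails x (y ∨ z).
  by move=> /entails_trans; apply; exact: entails_orl.
have orr x y z : entails x z -> entails x (y ∨ z).
  by move=> /entails_trans; apply; exact: entails_orr.
have r := entails_refl.
case=> {α β}.
- by move=> x y; split.
- by move=> x y; exact: equiv_andC.
- by move=> x y z; split; do !apply: entails_or; auto.
- by move=> x y z; split; entails_proj.
- by move=> x y; split; [apply: entails_or; entails_proj|auto].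
- by move=> x y; split; [entails_proj|apply: entails_and; auto].
- by move=> x; split; [apply: entails_or => //; exact: ax (A7 _)|auto].
- by move=> x; split; entails_proj.
- exact: equiv_and_imp.
- exact: equiv_and_impr.
- by move=> x; split; [entails_proj|exact: entails_top (imp_refl x) _].
- by split; [entails_proj|exact: ax A12].
- by split; [exact: ax A13|exact: ax (A7 _)].
- move=> x y; split; first exact: ax (A14 _ _).
  by apply: entails_or; apply: entails_neg; entails_proj.
Qed.

Lemma equiv_or α α' β β' :
  equiv α α' -> equiv β β' -> equiv (α ∨ β) (α' ∨ β').
Proof.
move=> [a a'] [b b']; split; apply: entails_or;
  by [apply: entails_trans (entails_orl _ _)
     |apply: entails_trans (entails_orr _ _)].
Qed.

Lemma equiv_and α α' β β' :
  equiv α α' -> equiv β β' -> equiv (α ∧ β) (α' ∧ β').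
Proof.
by move=> [a a'] [b b']; split; apply: entails_and;
  (exact: entails_andwr || exact: entails_andwl).
Qed.

Lemma equiv_imp α α' β β' :
  equiv α α' -> equiv β β' -> equiv (α ⇒ β) (α' ⇒ β').
Proof.
move=> [a a'] [b b']; split.
  apply: (@entails_trans _ (⊤ ∧ (α ⇒ β))); first entails_proj.
  by apply: entails_imp; exact: entails_andwl.
apply: (@entails_trans _ (⊤ ∧ (α' ⇒ β'))); first entails_proj.
by apply: entails_imp; exact: entails_andwl.
Qed.

Lemma equiv_neg α α' : equiv α α' -> equiv (∼ α) (∼ α').
Proof. by move=> [a a']; split; exact: entails_neg. Qed.

Lemma equiv_top α : equiv α ⊤ <-> derives Ax G α.
Proof.
split=> [[_ tα]|dα]; first exact: d_SMP (ax A6) tα.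
by split; [exact: entails_top (ax A6) _|exact: entails_top].
Qed.

(** The boolean form of [equiv], as the quotient construction expects. *)
Definition equivb : rel formula := fun α β => `[< equiv α β >].

Lemma equivb_refl : reflexive equivb.
Proof. by move=> α; apply/asboolP/equiv_refl. Qed.

Lemma equivb_sym : symmetric equivb.
Proof. by move=> α β; apply: asbool_equiv_eq; split; exact: equiv_sym. Qed.

Lemma equivb_trans : transitive equivb.
Proof.
by move=> β α γ /asboolP αβ /asboolP βγ; exact/asboolP/(equiv_trans αβ βγ).
Qed.

Canonical equiv_rel := EquivRel equivb equivb_refl equivb_sym equivb_trans.

Definition lind := {eq_quot equiv_rel}.

Let cls α : lind := \pi_lind α.

Lemma clsP α β : cls α = cls β <-> equiv α β.
Proof. by split=> [/eqmodP/asboolP|αβ]; last exact/eqmodP/asboolP. Qed.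

Lemma repr_cls α : equiv (repr (cls α)) α.
Proof. by apply/clsP; rewrite /cls reprK. Qed.

(** The Lindenbaum algebra: formulas up to interderivability from [G]. *)
Definition lindenbaum : algebra := {|
  carrier := lind;
  join := fun x y => cls (repr x ∨ repr y);
  meet := fun x y => cls (repr x ∧ repr y);
  imp := fun x y => cls (repr x ⇒ repr y);
  neg := fun x => cls (∼ repr x);
  bot := cls ⊥;
  top := cls ⊤
|}.

Lemma eval_lindenbaum (v : nat -> lindenbaum) φ :
  eval v φ = cls (subst (fun n => repr (v n)) φ).
Proof.
elim: φ => //= [n|α -> β ->|α -> β ->|α -> β ->|α ->].
- by rewrite /cls reprK.
- by apply/clsP/equiv_or; exact: repr_cls.
- by apply/clsP/equiv_and; exact: repr_cls.
- by apply/clsP/equiv_imp; exact: repr_cls.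
- by apply/clsP/equiv_neg; exact: repr_cls.
Qed.

Lemma lindenbaum_DHMSH : DHMSH lindenbaum.
Proof.
apply/DHMSH_satisfies => φ ψ Eφψ v; rewrite !eval_lindenbaum.
by apply/clsP/DHMSH_eqn_equiv; case: Eφψ => *; constructor.
Qed.

Lemma lindenbaum_top (v : nat -> lindenbaum) φ :
  eval v φ = top <-> derives Ax G (subst (fun n => repr (v n)) φ).
Proof. by rewrite eval_lindenbaum -equiv_top; exact: clsP. Qed.

(** Under the valuation sending each variable to its own class, the formulas
    with value [1] are the consequences of [G]. *)
Lemma lindenbaum_canonical φ :
  eval (fun n => cls (Var n) : lindenbaum) φ = top <-> derives Ax G φ.
Proof.
rewrite -equiv_top eval_lindenbaum -clsP.
suff -> : cls (subst (fun n => repr (cls (Var n))) φ) = cls φ by [].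
apply/clsP; elim: φ => /= *; try exact: equiv_refl.
- exact: repr_cls.
- exact: equiv_or.
- exact: equiv_and.
- exact: equiv_imp.
- exact: equiv_neg.
Qed.

End Lindenbaum.

(** * Logics and their classes of models *)

Lemma derives_mono (Ax Ax' G G' : formula -> Prop) :
  (forall δ, Ax δ -> Ax' δ) -> (forall γ, G γ -> G' γ) ->
  forall φ, derives Ax G φ -> derives Ax' G' φ.
Proof.
move=> AxAx' GG' φ; elim=> {φ} [φ /AxAx'|φ /GG'|φ γ _ ? _|φ γ _].
- exact: d_axiom.
- exact: d_premise.
- exact: d_SMP.
- exact: d_SCP.
Qed.

Lemma derives_subst (Ax : formula -> Prop) s φ : subst_closed Ax ->
  logic_theorem (derives Ax) φ -> logic_theorem (derives Ax) (subst s φ).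
Proof.
move=> Axs; elim=> {φ} [φ /Axs|//|φ γ _ ? _|φ γ _] //=.
- by move=> h; exact/d_axiom/h.
- exact: d_SMP.
- exact: d_SCP.
Qed.

Lemma DHMSH_axiom_subst : subst_closed DHMSH_axiom.
Proof. by move=> s φ []; move=> *; rewrite /=; constructor. Qed.

(** Two axiomatic extensions with the same models have the same
    consequences: the Lindenbaum algebra of a premise set [G] in the one is a
    model of the other. *)
Lemma axiomatizes_le L L' V : axiomatizes L V -> axiomatizes L' V ->
  forall G φ, L G φ -> L' G φ.
Proof.
move=> [[D [_ LD]] VL] [[D' [Ds' LD']] VL'] G φ /LD LGφ; apply/LD'.
set Ax' := adjoin DHMSH_axiom D' in LD' *.
have DAx' δ : DHMSH_axiom δ -> Ax' δ by left.
apply/(lindenbaum_canonical G DAx').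
have dA := lindenbaum_DHMSH G DAx'.
have Ax's : subst_closed Ax'.
  by move=> s δ [/DHMSH_axiom_subst|/Ds'] h; [left | right].
have /VL[_ AL] : V (lindenbaum G DAx').
  apply/VL'; split=> // δ /LD' /(derives_subst _ Ax's) Lδ v.
  by apply/lindenbaum_top; apply: derives_mono (Lδ _).
apply: soundness LGφ => // [δ Dδ|γ Gγ].
  by apply: AL; apply/LD; exact: d_axiom.
by apply/lindenbaum_canonical; exact: d_premise.
Qed.

(** * The variety generated by the twenty chains *)

(** An algebra whose points are separated by homomorphisms to members of [C20]
    embeds in a product of them. *)
Lemma separated_generated (A : algebra) :
  (forall x y : A, x <> y -> exists i n (f : A -> L_expansion i n),
     [/\ C20 (L_expansion i n), is_hom f & f x <> f y]) ->
  variety_generated C20 A.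
Proof.
move=> sepA V [_ VS VP] VC.
(* All the chains have carrier [chain3], so the homomorphisms range over a set
   of functions in the universe of the carrier of [A]. *)
pose I := {p : nat * chain3 * (A -> chain3) |
  C20 (L_expansion p.1.1 p.1.2) /\ @is_hom A (L_expansion p.1.1 p.1.2) p.2}.
pose F (p : I) := L_expansion (sval p).1.1 (sval p).1.2.
pose h (x : A) : product F := fun p => (sval p).2 x.
apply: (VS _ _ h); last by apply: VP => -[p [Cp hp]]; exact: VC.
  by split=> *; apply: functional_extensionality_dep => -[p [Cp []]] *;
    rewrite /h /=; auto.
move=> x y hxy; apply: contrapT => /sepA[i [n [f [Cin fhom]]]]; apply.
by have := congr1 (fun k => k (exist _ (i, n, f) (conj Cin fhom))) hxy.
Qed.

Lemma models_generated A : models DQDSHC3_axiom A -> variety_generated C20 A.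
Proof.
move=> [dA AAx]; have shA := dhm_sh dA.
have AAx2 (x y : A) δ : DQDSHC3_axiom δ ->
    eval (fun n => if n == 0 then x else y) δ = top.
  by move=> /AAx; exact.
have negneg_le (x : A) : le (neg (neg x)) x.
  have := AAx2 x x _ (or_introl (or_intror (DQD5 (Var 0)))).
  by move/(eval_ImpH _ _ _ shA).
have imp0_imp0 (x : A) : imp (imp x bot) bot = neg (imp x bot).
  pose a := imp (imp x bot) bot; pose b := neg (imp x bot).
  have ab : meet (imp a (meet a b)) (imp b (meet b a)) = top.
    exact: (AAx2 x x _ (or_intror (DQDSHC3_i (Var 0)))).
  apply: (le_anti shA); apply/(impH_eq1 shA)/(le1x shA); rewrite -ab.
    exact: leIl.
  exact: leIr.
have middle_le (x y : A) :
    le (meet x (neg (imp (neg x) bot))) (join y (imp y bot)).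
  have := AAx2 x y _ (or_intror (DQDSHC3_ii (Var 0) (Var 1))).
  by move/(eval_ImpH _ _ _ shA).
apply: separated_generated => x y /(germ_separation dA negneg_le)[U mU nxy].
have [i [n [Cin ghom]]] := germ_hom dA negneg_le imp0_imp0 middle_le mU.
exists i, n, (germ U); split=> // gxy; apply: nxy.
exact/(germP dA negneg_le imp0_imp0 middle_le mU).
Qed.

Lemma generated_models A : variety_generated C20 A <-> models DQDSHC3_axiom A.
Proof.
split; last exact: models_generated.
by apply; [exact: models_variety | exact: C20_models].
Qed.

Theorem theorem7p7 :
  corresponding_logic DQDSHC3
    (derives (adjoin DQDSH_axiom DQDSHC3_new_axiom)).
Proof.
have ax : axiomatizes (derives DQDSHC3_axiom) DQDSHC3.
  split; last first.
    move=> A; split=> [/generated_models/models_theorem //|AL].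
    exact/generated_models/models_theorem.
  exists (adjoin DQDSH_new_axiom DQDSHC3_new_axiom); split.
    by move=> s φ [[]|[]] *; [left..|right|right]; rewrite /=; constructor.
  by move=> G φ; split; apply: derives_mono => //;
     rewrite /DQDSHC3_axiom /DQDSH_axiom /adjoin; tauto.
split=> // L' axL' G φ.
by split; [exact: axiomatizes_le axL' ax G φ
          |exact: axiomatizes_le ax axL' G φ].
Qed.
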